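(* Let $w(x,y,t)=x^2+y^2+4t$ and let $p\in P_m(\mathbb H)$. Then there is a unique polynomial $q$ of weighted degree at most $m-2$ such that $$\Delta_H\bigl((1-w)q\bigr)=-\Delta_Hp.$$ Consequently, $u=p+(1-w)q$ is a harmonic polynomial (i.e. $\Delta_Hu=0$) and $u=p$ on the paraboloid $$\{w=1\}=\left\{t=\frac{1-|z|^2}{4}\right\}.$$
   Context: $\mathbb H=\mathbb C\times\mathbb R$ is the first Heisenberg group, $z=x+iy$, with coordinates $(x,y,t)$. The horizontal fields are $X=\partial_x+2y\partial_t$, $Y=\partial_y-2x\partial_t$, and the sub-Laplacian is $\Delta_H=X^2+Y^2$. Dilations are $\delta_r(z,t)=(rz,r^2t)$. For $m\ge0$, $P_m(\mathbb H)$ is the space of polynomials $p$ in $(x,y,t)$ with complex coefficients such that $p\circ\delta_r=r^mp$ for every $r>0$; $P_j(\mathbb H)=\{0\}$ for $j<0$. A polynomial has weighted degree at most $d$ if it belongs to $\bigoplus_{j\le d}P_j(\mathbb H)$ (so only $q=0$ has weighted degree at most $d$ when $d<0$). *)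

(* Defs.v *)
From mathcomp Require Import all_boot all_order all_algebra.
From mathcomp Require Import reals complex mpoly.

Set Implicit Arguments.
Unset Strict Implicit.
Unset Printing Implicit Defensive.

Import Order.TTheory GRing.Theory Num.Theory.
Local Open Scope ring_scope.
Local Open Scope complex_scope.

(* Points (z, t) of H = C x R, with real coordinates x = Re z, y = Im z, t. *)
Definition heis (R : realType) : Type := (R[i] * R)%type.

(* Polynomials in (x, y, t) with complex coefficients. *)
Definition hpoly (R : realType) := {mpoly R[i][3]}.

Definition Px {R : realType} : hpoly R := 'X_(0 : 'I_3).
Definition Py {R : realType} : hpoly R := 'X_(1 : 'I_3).
Definition Pt {R : realType} : hpoly R := 'X_(2 : 'I_3).

Definition evalH (R : realType) (p : hpoly R) (h : heis R) : R[i] :=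
  p.@[tnth [tuple (complex.Re h.1)%:C; (complex.Im h.1)%:C; h.2%:C]].

Definition dx (R : realType) (p : hpoly R) : hpoly R := mderiv (0 : 'I_3) p.
Definition dy (R : realType) (p : hpoly R) : hpoly R := mderiv (1 : 'I_3) p.
Definition dt (R : realType) (p : hpoly R) : hpoly R := mderiv (2 : 'I_3) p.

Definition fieldX (R : realType) (p : hpoly R) : hpoly R :=
  dx p + 2%:R * Py * dt p.
Definition fieldY (R : realType) (p : hpoly R) : hpoly R :=
  dy p - 2%:R * Px * dt p.

Definition sublaplacian (R : realType) (p : hpoly R) : hpoly R :=
  fieldX (fieldX p) + fieldY (fieldY p).

Definition harmonic (R : realType) (p : hpoly R) : Prop := sublaplacian p = 0.

Definition dilation (R : realType) (r : R) (h : heis R) : heis R :=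
  (r%:C * h.1, r ^+ 2 * h.2).

(* p lies in P_m(H). *)
Definition homogH (R : realType) (m : nat) (p : hpoly R) : Prop :=
  forall r : R, 0 < r ->
  forall h : heis R, evalH p (dilation r h) = r%:C ^+ m * evalH p h.

(* q lies in the sum of the P_j(H) for j <= d; since P_j(H) = 0 for j < 0, only
   j = 0, ..., d contribute, and there are no such j when d < 0. *)
Definition wdeg_le (R : realType) (d : int) (q : hpoly R) : Prop :=
  match d with
  | Posz n => exists f : 'I_n.+1 -> hpoly R,
                (forall j : 'I_n.+1, homogH j (f j)) /\ q = \sum_(j < n.+1) f j
  | Negz _ => q = 0
  end.

Definition wpoly {R : realType} : hpoly R := Px ^+ 2 + Py ^+ 2 + 4%:R * Pt.

(* Main.v *)
Require Import Defs.
From HB Require Import structures.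
From mathcomp Require Import all_boot all_order all_algebra.
From mathcomp Require Import reals complex mpoly.
From mathcomp Require Import ring lra zify.

(** Write z = x + i y. In the coordinates (z, zbar, t) the sub-Laplacian is
      L = 4 (d_z d_zbar + z zbar d_t^2 - i (z d_z - zbar d_zbar) d_t)
    and w = z zbar + 4 t. Give z^a zbar^b t^n the weight a + b + 2 n. Since L
    lowers weights by 2 and the multiplication by 1 - w raises them by at most
    2, the map q |-> L((1 - w) q) is an endomorphism of the finite-dimensional
    space of polynomials of weighted degree at most m - 2, which contains L p.
    Existence and uniqueness of q thus follow from the injectivity of this map,
    which holds on all polynomials ([zlap_1Bzw_inj]).

    For the injectivity, let q have top component q_D of weight D, and let
    L((1 - w) q) = 0. Then w q_D is harmonic, and it vanishes on the cone
    t = - z zbar / 4. The operator L only relates the coefficients c_n of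
    z^(A - n) zbar^(B - n) t^n along a line of fixed A and B. With
    k = min(A, B), l = |A - B| and e = i or e = - i according to the sign of
    A - B, harmonicity amounts to
      c_(k - j) = c_k k (k - 1) ... (k - j + 1) d_j,
      j (j + l) d_j = e l d_(j-1) - d_(j-2),  d_0 = 1,
    where d_j depends neither on k nor on c. The vanishing on the cone becomes
    c_k F_k(-4) = 0, where F_k(y) = sum_j k (k - 1) ... (k - j + 1) d_j y^j, so
    all that is needed is F_k(-4) <> 0 ([hsum_neq0]).

    If l > 0, the three-term recurrence
      (k + 2 + l) F_(k+2)
        = (2 k + l + 3 + e l y) F_(k+1) - (k + 1) (1 + y^2) F_k
    shows by induction that the imaginary part of F_(k+1) / F_k has a constant
    strict sign for every real y <> 0, so F_k has no real zero. If l = 0, then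
    F_k(y) = (1 + y^2)^(k/2) P_k((1 + y^2)^(-1/2)) for the Legendre polynomial
    P_k, and real zeros exist; but F_k(-4) is the odd integer
    sum_i (-4)^i C(2i, i) C(k, 2i).

    Homogeneity under dilations is a statement on values. It is turned into the
    statement that all monomials have the same weight by the fact that a
    polynomial that vanishes at all points with natural coordinates is 0
    ([mpoly3_nat_eq0]). *)

Set Implicit Arguments.
Unset Strict Implicit.
Unset Printing Implicit Defensive.

Import Order.TTheory GRing.Theory Num.Theory.
Local Open Scope ring_scope.

(** * Harmonic polynomials along one line of monomials *)

Section Line.
Variable C : numClosedFieldType.
Implicit Types (e y : C) (l k j : nat).

(** The coefficients d_j of the introduction, with d_(-1) = 0: carrying the
    pair (d_j, d_(j-1)) makes the second-order recurrence structural. *)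
Fixpoint hcoef_rec e l j : C * C :=
  if j is j'.+1 then
    ((e * l%:R * (hcoef_rec e l j').1 - (hcoef_rec e l j').2)
       / (j'.+1 * (j'.+1 + l))%:R, (hcoef_rec e l j').1)
  else (1, 0).

Definition hcoef e l j : C := (hcoef_rec e l j).1.

Lemma hcoefSS e l j :
  (j.+2 * (j.+2 + l))%:R * hcoef e l j.+2 = e * l%:R * hcoef e l j.+1 - hcoef e l j.
Proof. by rewrite {1}/hcoef /= mulrC divfK // pnatr_eq0. Qed.

Lemma hcoef1 e l : (1 + l)%:R * hcoef e l 1 = e * l%:R.
Proof. by rewrite /hcoef /= mul1n mulrC divfK ?pnatr_eq0 // mulr1 subr0. Qed.

(** Let s = z zbar. For y = s / t this is t ^ (- k) times the polynomial
    sum_j k (k - 1) ... (k - j + 1) d_j s^j t^(k - j), whose product with z^l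
    or zbar^l, according to the sign of e, is harmonic. *)
Definition hsum e l y k : C :=
  \sum_(j < k.+1) (k ^_ j)%:R * hcoef e l j * y ^+ j.

Lemma hsumE e l y k N : (k < N)%N ->
  hsum e l y k = \sum_(j < N) (k ^_ j)%:R * hcoef e l j * y ^+ j.
Proof.
move=> kN; rewrite -(subnKC kN) big_split_ord /= [X in _ + X]big1 ?addr0 //.
by move=> i _; rewrite ffact_small ?mul0r // leq_addr.
Qed.

(** No truncation appears on the right, since the factor n ^_ m vanishes as
    soon as n < m. *)
Lemma ffactSr_natr (n m : nat) :
  (n ^_ m.+1)%:R = (n ^_ m)%:R * (n%:R - m%:R) :> C.
Proof.
rewrite ffactnSr natrM; case: (leqP m n) => [mn | nm]; first by rewrite natrB.
by rewrite ffact_small // !mul0r.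
Qed.

(** The profiles for consecutive k satisfy a three-term recurrence because the
    d_j do not depend on k: the coefficients of y^j on both sides share the
    factor (k + 1) k (k - 1) ... (k - j + 3), and after dividing by it the
    identity becomes the recurrence that defines d_j. *)
Lemma hsum_rec e l y k :
  (k.+2 + l)%:R * hsum e l y k.+2 =
  ((k.*2 + l + 3)%:R + e * l%:R * y) * hsum e l y k.+1
  - k.+1%:R * (1 + y ^+ 2) * hsum e l y k.
Proof.
have S1 : y * hsum e l y k.+1 =
    \sum_(j < k.+3) (k.+1 ^_ j.-1)%:R * (0 < j)%:R * hcoef e l j.-1 * y ^+ j.
  rewrite (@hsumE _ _ _ _ k.+2) // [RHS]big_ord_recl /= mulr0 !mul0r add0r mulr_sumr.
  by apply: eq_bigr => i _; rewrite mulr1 /bump /= add1n exprS; ring.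
have S2 : y ^+ 2 * hsum e l y k =
    \sum_(j < k.+3) (k ^_ j.-2)%:R * (1 < j)%:R * hcoef e l j.-2 * y ^+ j.
  rewrite 2![in RHS]big_ord_recl /= !mulr0 !mul0r !add0r mulr_sumr.
  by apply: eq_bigr => i _; rewrite mulr1 /bump /= !add1n !exprS; ring.
have -> : ((k.*2 + l + 3)%:R + e * l%:R * y) * hsum e l y k.+1
    - k.+1%:R * (1 + y ^+ 2) * hsum e l y k
  = (k.*2 + l + 3)%:R * hsum e l y k.+1 + e * l%:R * (y * hsum e l y k.+1)
    - (k.+1%:R * hsum e l y k + k.+1%:R * (y ^+ 2 * hsum e l y k)) by ring.
rewrite S1 S2 !(@hsumE _ _ _ _ k.+3) ?ltnS ?leqnSn //; last exact: leqW.
rewrite !mulr_sumr -!big_split /= -sumrB.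
apply: eq_bigr => -[[|[|j]] ltj] _ /=.
- rewrite !ffactn0 !expr0 /hcoef /= ?(mulr0, mul0r) -muln2; ring.
- have := hcoef1 e l; rewrite !ffactn0 !ffactn1 expr1 [hcoef _ _ 0]/hcoef /= => p1.
  rewrite ?(mulr0, mul0r, mulr1, mul1r) -p1 -muln2.
  ring.
- have fSS n m : (n.+1 ^_ m.+1)%:R = n.+1%:R * (n ^_ m)%:R :> C by rewrite ffactSS natrM.
  rewrite (fSS k.+1) !(fSS k) !(ffactSr_natr k).
  have p := hcoefSS e l j.
  have pk : hcoef e l j = e * l%:R * hcoef e l j.+1 - (j.+2 * (j.+2 + l))%:R * hcoef e l j.+2.
    by rewrite p; ring.
  rewrite pk -muln2; ring.
Qed.

Lemma hsum0 e l y : hsum e l y 0 = 1.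
Proof. by rewrite /hsum big_ord1 /hcoef /= !mulr1. Qed.

Lemma hsum1 e l y : (1 + l)%:R * hsum e l y 1 = (1 + l)%:R + e * l%:R * y.
Proof.
rewrite /hsum big_ord_recr big_ord1 /= ffactn0 ffactn1 -hcoef1 {1}/hcoef /= expr1.
ring.
Qed.

(** For real y and imaginary e, the recurrence for F_k := hsum e l y k has real
    coefficients apart from e l y. Multiplied by the conjugate of F_(k+1), it
    shows that the imaginary part of F_(k+1) / F_k, oriented by that of
    e y, stays strictly positive once it is nonnegative; l > 0 gives the
    strictness. *)
Lemma hsum_neq0_gt0 e l y k : e^* = - e -> e != 0 -> y \is Num.real -> y != 0 ->
  (0 < l)%N -> hsum e l y k != 0.
Proof.
move=> ec e0 yr y0 l0; pose F := hsum e l y.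
have yc : y^* = y by apply/conj_Creal.
(* Up to a positive factor, Q n is the imaginary part of F n.+1 / F n with the
   sign of the imaginary part of e * y. *)
pose Q n := (e * y) * ((F n.+1)^* * F n - F n.+1 * (F n)^*).
have cc : 0 < (e * y) * (e * y)^*  by rewrite mul_conjC_gt0 mulf_neq0.
have F0 n : 0 < Q n -> F n.+1 != 0.
  by apply: contraTneq => F0; rewrite /Q F0 rmorph0 !mul0r subrr mulr0 ltxx.
suff Q0 n : 0 < Q n.
  by case: k => [|k]; [rewrite hsum0 oner_neq0 | exact: F0].
elim: n => [|n IHn].
  rewrite -(@pmulr_rgt0 _ (1 + l)%:R) ?ltr0n // /Q.
  have F1 := hsum1 e l y; have := congr1 Num.conj F1.
  rewrite rmorphM rmorphD !rmorphM /= !conjC_nat ec yc => F1c.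
  rewrite [X in 0 < X](_ : _ = (2 * l)%:R * (e * y * (e * y)^*)).
    by rewrite mulr_gt0 // ltr0n muln_gt0 l0.
  rewrite rmorphM /= ec yc /F hsum0 rmorph1 !mulr1.
  have -> : (1 + l)%:R * (e * y * ((hsum e l y 1)^* - hsum e l y 1)) =
    e * y * ((1 + l)%:R * (hsum e l y 1)^* - (1 + l)%:R * hsum e l y 1) by ring.
  by rewrite F1c F1; ring.
rewrite -(@pmulr_rgt0 _ (n.+2 + l)%:R) ?ltr0n //.
have R1 := hsum_rec e l y n; rewrite -!/(F _) in R1.
have R2 : (n.+2 + l)%:R * (F n.+2)^* = ((n.*2 + l + 3)%:R - e * l%:R * y) * (F n.+1)^*
    - n.+1%:R * (1 + y ^+ 2) * (F n)^*.
  have Ac : ((n.*2 + l + 3)%:R + e * l%:R * y)^* = (n.*2 + l + 3)%:R - e * l%:R * y.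
    by move: (_ + _ + 3)%N => a; rewrite rmorphD !rmorphM !rmorph_nat /= yc ec !mulNr.
  have Bc : (n.+1%:R * (1 + y ^+ 2))^* = n.+1%:R * (1 + y ^+ 2).
    by rewrite rmorphM rmorph_nat rmorphD rmorph1 rmorphXn /= yc.
  have := congr1 (fun z => z^*) R1.
  move: (n.+2 + l)%N (_%:R + e * l%:R * y) (n.+1%:R * _) Ac Bc => a b c bc cc'.
  by rewrite rmorphB !rmorphM rmorph_nat /= bc cc'.
rewrite [X in 0 < X](_ : _ = (2 * l)%:R * (e * y * (e * y)^*) * (F n.+1 * (F n.+1)^*)
  + n.+1%:R * (1 + y ^+ 2) * Q n).
  apply: ltr_pwDl; last first.
    apply/mulr_ge0/ltW => //; rewrite mulr_ge0 ?ler0n // addr_ge0 ?ler01 //.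
    by rewrite real_exprn_even_ge0.
  by rewrite mulr_gt0 ?mul_conjC_gt0 ?F0 // mulr_gt0 // ltr0n muln_gt0 l0.
rewrite rmorphM /= ec yc /Q.
have -> : (n.+2 + l)%:R * (e * y * ((F n.+2)^* * F n.+1 - F n.+2 * (F n.+1)^*))
  = e * y * ((n.+2 + l)%:R * (F n.+2)^* * F n.+1 - (n.+2 + l)%:R * F n.+2 * (F n.+1)^*)
  by ring.
rewrite R1 R2; ring.
Qed.

(** For l = 0 the recurrence decouples by parity, and d_(2i) is the
    coefficient (-1)^i / (4^i i!^2) of the Bessel function J_0. *)
Lemma hcoef0_odd e i : hcoef e 0 i.*2.+1 = 0.
Proof.
elim: i => [|i IHi]; first by rewrite /hcoef /= !(mulr0, mul0r) subr0 mul0r.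
have /eqP := hcoefSS e 0 i.*2.+1; rewrite IHi !(mulr0, mul0r) subr0 mulf_eq0.
by rewrite pnatr_eq0 /= doubleS => /eqP.
Qed.

Lemma hcoef0_even e i :
  hcoef e 0 i.*2 * (4 ^+ i * (i`! * i`!)%:R) = (- 1) ^+ i.
Proof.
elim: i => [|i IHi]; first by rewrite /hcoef /= !mul1r.
rewrite doubleS [RHS]exprS -IHi mulN1r.
have p := hcoefSS e 0 i.*2; rewrite mulr0 mul0r sub0r addn0 in p.
have -> : hcoef e 0 i.*2 = - ((i.*2.+2 * i.*2.+2)%:R * hcoef e 0 i.*2.+2) by rewrite p opprK.
rewrite factS exprS -muln2 !natrM; ring.
Qed.

(** For l = 0 the F_k are, up to a power, Legendre polynomials, which do have
    real zeros: the point -4 itself has to matter. Here F_k(-4) is the odd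
    integer sum_i (-4)^i C(2i, i) C(k, 2i). *)
Lemma hsum_neq0_eq0 e k : hsum e 0 (- 4) k != 0.
Proof.
suff [z ->] : exists z : int, hsum e 0 (- 4) k = (1 + 2 * z)%:~R.
  rewrite intr_eq0; apply/eqP => /(congr1 (fun z => z %% 2)%Z); lia.
rewrite /hsum big_ord_recl /= ffactn0 [hcoef _ _ _]/hcoef /= !mulr1.
suff [z ->] : exists z : int,
  \sum_(i < k) (k ^_ (bump 0 i))%:R * hcoef e 0 (bump 0 i) * (- 4) ^+ bump 0 i
   = (2 * z)%:~R :> C by exists z; rewrite intrD.
apply: (big_ind (fun x => exists z : int, x = (2 * z)%:~R)).
- by exists 0.
- by move=> _ _ [u ->] [v ->]; exists (u + v); rewrite mulrDr intrD.
move=> i _; rewrite /bump /= add1n.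
have [n [->|->]] : exists n, (i.+1 = n.*2.+1 \/ i.+1 = n.+1.*2)%N.
- by exists i./2; lia.
- by exists 0; rewrite hcoef0_odd mulr0 mul0r.
move: n.+1 (ltn0Sn n) => m m0.
exists (2 * (- 4) ^+ m.-1 * - ('C(m.*2, m) * 'C(k, m.*2))%:R).
have -> (N : int) : 2 * (2 * (- 4) ^+ m.-1 * - N) = (- 4) ^+ m * N.
  by case: m m0 => // m0 _; rewrite exprS /=; ring.
rewrite rmorphM rmorph_nat rmorphXn /= [(-4)%:~R]/= natrM.
rewrite -bin_ffact -(@bin_fact m.*2 m) -addnn ?leq_addr // addnK !natrM.
have -> : (-4 : C) ^+ (m + m) = 4 ^+ m * 4 ^+ m.
  by rewrite addnn -mul2n exprM sqrrN -exprM mul2n -addnn exprD.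
have p := hcoef0_even e m; rewrite natrM -addnn in p.
have -> : ((-4)%:~R : C) ^+ m = 4 ^+ m * (-1) ^+ m by rewrite -exprMn mulrN1 intrN.
rewrite -p; ring.
Qed.

Lemma hsum_neq0 e l k : e = 'i \/ e = - 'i -> hsum e l (- 4) k != 0.
Proof.
case: l => [_|l ei]; first exact: hsum_neq0_eq0.
have [ec e0] : e^* = - e /\ e != 0.
  by case: ei => ->; rewrite ?rmorphN /= conjCi ?opprK ?oppr_eq0 neq0Ci.
apply: hsum_neq0_gt0 => //; first by rewrite rpredN realn.
by rewrite oppr_eq0 pnatr_eq0.
Qed.

(** A harmonic homogeneous polynomial that vanishes on the cone w = 0 has no
    coefficients on the line of monomials z^(A - n) zbar^(B - n) t^n. The
    recurrence for c is harmonicity, and the zero sum is the vanishing after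
    the substitution t = - z zbar / 4. The solution of the
    recurrence turns the latter into c_k (-1/4)^k F_k(-4) = 0. *)
Lemma harmonic_line_eq0 e l k (c : nat -> C) : e = 'i \/ e = - 'i ->
  (forall n, (k < n)%N -> c n = 0) ->
  (forall j, (j < k)%N ->
     (j.+1 * (j.+1 + l))%:R * c (k - j.+1)%N =
     e * l%:R * (k - j)%:R * c (k - j)%N
     - ((k - j).+1 * (k - j))%:R * c (k - j).+1) ->
  \sum_(n < k.+1) c n * (- 4^-1) ^+ n = 0 ->
  forall n, c n = 0.
Proof.
move=> ei c0 crec csum.
have cE j : (j <= k)%N -> c (k - j)%N = c k * (k ^_ j)%:R * hcoef e l j.
  elim/ltn_ind: j => -[|[|j]] IH jk.
  - by rewrite subn0 /hcoef /= !mulr1.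
  - have := crec 0%N jk; rewrite subn0 (c0 k.+1) // mulr0 subr0 mul1n => E.
    apply: (@mulfI _ (1 + l)%:R); first by rewrite pnatr_eq0.
    by rewrite E mulrCA hcoef1 ffactn1; ring.
  apply: (@mulfI _ (j.+2 * (j.+2 + l))%:R); first by rewrite pnatr_eq0.
  have kj : (k - j.+1).+1 = (k - j)%N by lia.
  rewrite crec // mulrCA hcoefSS kj !IH //; try lia.
  rewrite !ffactSr_natr natrM !natrB; try lia.
  ring.
have ck : c k = 0.
  apply/eqP; move/eqP: csum; rewrite (reindex_inj rev_ord_inj) /=.
  have -> : \sum_(j < k.+1) c (k.+1 - j.+1)%N * (- 4^-1) ^+ (k.+1 - j.+1)
     = c k * (- 4^-1) ^+ k * hsum e l (- 4) k.
    rewrite /hsum mulr_sumr; apply: eq_bigr => j _.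
    have jk : (j <= k)%N by rewrite -ltnS.
    rewrite subSS cE //.
    have -> : (- 4^-1) ^+ k = (- 4^-1) ^+ (k - j) * (- 4^-1) ^+ j :> C.
      by rewrite -exprD subnK.
    have : (- 4^-1) ^+ j * (- 4) ^+ j = 1 :> C.
      by rewrite -exprMn mulrNN mulVf ?expr1n // pnatr_eq0.
    move: ((- 4^-1) ^+ j) ((-4) ^+ j) => a b ab; rewrite -[LHS]mulr1 -ab; ring.
  rewrite !mulf_eq0 (negPf (hsum_neq0 _ _ ei)) orbF expf_eq0.
  by rewrite oppr_eq0 invr_eq0 pnatr_eq0 andbF orbF.
move=> n; case: (leqP n k) => [nk|]; last exact: c0.
by rewrite -(subKn nk) cE ?leq_subr // ck !mul0r.
Qed.
End Line.

(** * Injective endomorphisms of spaces spanned by finitely many monomials *)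

Section FinitelyManyMonomials.
Variables (K : fieldType) (n : nat).

(** The polynomials with support in S form a finite-dimensional space, on which
    T acts by the square matrix M of its values on monomials. *)
Lemma mpoly_linear_inj_surj (T : {linear {mpoly K[n]} -> {mpoly K[n]}})
    (S : pred 'X_{1..n}) (N : nat) :
  (forall s, S s -> (mdeg s < N)%N) ->
  (forall q, {subset msupp q <= S} -> {subset msupp (T q) <= S}) ->
  (forall q, T q = 0 -> q = 0) ->
  forall g, {subset msupp g <= S} ->
  exists2 q, {subset msupp q <= S} & T q = g.
Proof.
move=> SN TS Tinj g gS.
pose J : finType := {s : 'X_{1..n < N} | S (bmnm s)}.
pose ev (i : 'I_#|J|) : 'X_{1..n} := val (val (enum_val i)).
have evS i : S (ev i) := valP (enum_val i).
have ev_inj : injective ev by move=> i j /val_inj/val_inj/enum_val_inj.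
have evP s : S s -> exists i, s = ev i.
  move=> Ss; pose j : J := exist _ (BMultinom (SN s Ss)) Ss.
  by exists (enum_rank j); rewrite /ev enum_rankK.
pose enc (v : 'rV[K]_#|J|) := \sum_i v 0 i *: 'X_[ev i].
have encE v j : (enc v)@_(ev j) = v 0 j.
  rewrite raddf_sum (bigD1 j) //= mcoeffZ mcoeffX eqxx mulr1 big1 ?addr0 // => i ij.
  by rewrite mcoeffZ mcoeffX (inj_eq ev_inj) (negPf ij) mulr0.
have encS v : {subset msupp (enc v) <= S}.
  move=> s; rewrite mcoeff_msupp; apply: contraR => Ss.
  rewrite raddf_sum big1 // => i _ /=; rewrite mcoeffZ mcoeffX.
  by case: eqP => [e|_]; [case/negP: Ss; rewrite -e; exact: evS | rewrite mulr0].
have eqS p q : {subset msupp p <= S} -> {subset msupp q <= S} ->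
    (forall i, p@_(ev i) = q@_(ev i)) -> p = q.
  move=> pS qS pq; apply/mpolyP => s; case Ss: (S s).
    by have [i ->] := evP s Ss.
  have out r : {subset msupp r <= S} -> r@_s = 0.
    by move=> rS; apply: memN_msupp_eq0; apply/negP => /rS; rewrite unfold_in Ss.
  by rewrite !out.
pose M : 'M[K]_#|J| := \matrix_(i, j) (T 'X_[ev i])@_(ev j).
have ME v j : (v *m M) 0 j = (T (enc v))@_(ev j).
  rewrite linear_sum raddf_sum mxE; apply: eq_bigr => i _ /=.
  by rewrite mxE linearZ /= mcoeffZ.
have Mu : M \in unitmx.
  rewrite -row_free_unit; apply: inj_row_free => v vM.
  have T0 : T (enc v) = 0.
    apply: eqS => [||i]; [exact/TS/encS | by move=> s; rewrite msupp0 | ].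
    by rewrite -ME vM mxE mcoeff0.
  by apply/rowP => j; rewrite -encE (Tinj _ T0) mcoeff0 mxE.
pose v := (\row_j g@_(ev j)) *m invmx M.
exists (enc v); first exact: encS.
apply: eqS => [||i] //; first exact/TS/encS.
by rewrite -ME /v mulmxKV // mxE.
Qed.
End FinitelyManyMonomials.

(** * The sub-Laplacian in the coordinates z, zbar, t *)

Section Monomials.
Variable C : numClosedFieldType.
Local Notation mp := {mpoly C[3]}.
Implicit Types (p q u : mp) (a b n : nat).

Definition mon a b n : 'X_{1..3} := [multinom tnth [tuple a; b; n] i | i < 3].
(** The weighted degree of a monomial. It is the same for monomials in
    (x, y, t) and in (z, zbar, t). *)
Definition wt (s : 'X_{1..3}) : nat :=
  (s (0%R : 'I_3) + s (1%R : 'I_3) + 2 * s (2%R : 'I_3))%N.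

Lemma ord3P (P : 'I_3 -> Prop) : P 0 -> P 1 -> P 2 -> forall i, P i.
Proof.
move=> P0 P1 P2 [[|[|[|//]]] lti].
- by rewrite (_ : Ordinal lti = 0) //; apply: val_inj.
- by rewrite (_ : Ordinal lti = 1) //; apply: val_inj.
- by rewrite (_ : Ordinal lti = 2) //; apply: val_inj.
Qed.

Lemma monE (s : 'X_{1..3}) : s = mon (s (0%R : 'I_3)) (s (1%R : 'I_3)) (s (2%R : 'I_3)).
Proof. by apply/(mnmP _ _); apply: ord3P; rewrite mnmE. Qed.

Lemma wt_mon a b n : wt (mon a b n) = (a + b + 2 * n)%N.
Proof. by rewrite /wt !mnmE. Qed.

Lemma mon0S a b n : mon a.+1 b n = (mon a b n + U_(0%R : 'I_3))%MM.
Proof. by apply/(mnmP _ _); apply: ord3P; rewrite mnmDE mnm1E !mnmE //= ?addn0 ?addn1. Qed.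
Lemma mon1S a b n : mon a b.+1 n = (mon a b n + U_(1%R : 'I_3))%MM.
Proof. by apply/(mnmP _ _); apply: ord3P; rewrite mnmDE mnm1E !mnmE //= ?addn0 ?addn1. Qed.
Lemma mon2S a b n : mon a b n.+1 = (mon a b n + U_(2%R : 'I_3))%MM.
Proof. by apply/(mnmP _ _); apply: ord3P; rewrite mnmDE mnm1E !mnmE //= ?addn0 ?addn1. Qed.

Lemma mcoeffXM_eq0 (i : 'I_3) p (s : 'X_{1..3}) : s i = 0%N -> ('X_i * p)@_s = 0.
Proof.
move=> si; apply: memN_msupp_eq0; rewrite mulrC (perm_mem (msuppMX _ _)).
apply/mapP => -[s' _ e]; move/(mnmP _ _)/(_ i): e.
by rewrite mnmDE mnm1E eqxx si.
Qed.

Lemma mcoeffXMD (i : 'I_3) p s : ('X_i * p)@_(s + U_(i))%MM = p@_s.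
Proof. by rewrite mulrC addmC mcoeffMX. Qed.

End Monomials.

Section Wirtinger.
Variable C : numClosedFieldType.
Local Notation mp := {mpoly C[3]}.
Implicit Types (p q u : mp) (a b n : nat).

Lemma mcoeff_d0 p a b n :
  (mderiv (0 : 'I_3) p)@_(mon a b n) = a.+1%:R * p@_(mon a.+1 b n).
Proof. by rewrite mcoeff_mderiv -mon0S mnmE mulr_natl. Qed.
Lemma mcoeff_d1 p a b n :
  (mderiv (1 : 'I_3) p)@_(mon a b n) = b.+1%:R * p@_(mon a b.+1 n).
Proof. by rewrite mcoeff_mderiv -mon1S mnmE mulr_natl. Qed.
Lemma mcoeff_d2 p a b n :
  (mderiv (2 : 'I_3) p)@_(mon a b n) = n.+1%:R * p@_(mon a b n.+1).
Proof. by rewrite mcoeff_mderiv -mon2S mnmE mulr_natl. Qed.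

Lemma mcoeff_X0 p a b n :
  ('X_(0 : 'I_3) * p)@_(mon a b n) = if a is a'.+1 then p@_(mon a' b n) else 0.
Proof. by case: a => [|a]; rewrite ?mon0S ?mcoeffXMD // mcoeffXM_eq0 // mnmE. Qed.
Lemma mcoeff_X1 p a b n :
  ('X_(1 : 'I_3) * p)@_(mon a b n) = if b is b'.+1 then p@_(mon a b' n) else 0.
Proof. by case: b => [|b]; rewrite ?mon1S ?mcoeffXMD // mcoeffXM_eq0 // mnmE. Qed.
Lemma mcoeff_X2 p a b n :
  ('X_(2 : 'I_3) * p)@_(mon a b n) = if n is n'.+1 then p@_(mon a b n') else 0.
Proof. by case: n => [|n]; rewrite ?mon2S ?mcoeffXMD // mcoeffXM_eq0 // mnmE. Qed.

Definition coef_pred01 p a b n : C :=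
  if a is a'.+1 then if b is b'.+1 then p@_(mon a' b' n) else 0 else 0.

Lemma mcoeff_X01 p a b n :
  ('X_(0 : 'I_3) * ('X_(1 : 'I_3) * p))@_(mon a b n) = coef_pred01 p a b n.
Proof. by rewrite mcoeff_X0; case: a => // a; rewrite mcoeff_X1. Qed.

(** The variables 0, 1, 2 stand for z, zbar, t; [hlap_of_z] relates zlap to the
    sub-Laplacian. *)
Definition zlap p : mp :=
  4 *: (mderiv (1 : 'I_3) (mderiv (0 : 'I_3) p)
    + 'X_(0 : 'I_3) * ('X_(1 : 'I_3) * mderiv (2 : 'I_3) (mderiv (2 : 'I_3) p))
    - 'i *: ('X_(0 : 'I_3) * mderiv (0 : 'I_3) (mderiv (2 : 'I_3) p)
             - 'X_(1 : 'I_3) * mderiv (1 : 'I_3) (mderiv (2 : 'I_3) p))).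

Lemma mcoeff_zlap p a b n : (zlap p)@_(mon a b n) =
  4 * ((a.+1 * b.+1)%:R * p@_(mon a.+1 b.+1 n)
       + (n.+2 * n.+1)%:R * coef_pred01 p a b n.+2
       - 'i * (a%:R - b%:R) * n.+1%:R * p@_(mon a b n.+1)).
Proof.
rewrite mcoeffZ mcoeffB mcoeffD mcoeffZ mcoeffB mcoeff_X01 mcoeff_X0 mcoeff_X1.
case: a b => [|a] [|b] /=;
  rewrite ?mcoeff_X1 ?mcoeff_d1 ?mcoeff_d0 ?mcoeff_d2 ?mcoeff_d2 ?mulr0; ring.
Qed.

Definition zw : mp := 'X_(0 : 'I_3) * 'X_(1 : 'I_3) + 4 *: 'X_(2 : 'I_3).

Lemma mcoeff_1Bzw q a b n : ((1 - zw) * q)@_(mon a b n) =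
  q@_(mon a b n)
  - coef_pred01 q a b n - 4 * (if n is n'.+1 then q@_(mon a b n') else 0).
Proof.
rewrite mulrBl mul1r mulrDl -mulrA -scalerAl mcoeffB mcoeffD mcoeffZ.
by rewrite mcoeff_X01 mcoeff_X2 opprD addrA.
Qed.

Lemma mpoly_mon0P q : (forall a b n, q@_(mon a b n) = 0) -> q = 0.
Proof. by move=> q0; apply/mpolyP => s; rewrite (monE s) q0 mcoeff0. Qed.

(** The coefficients of u = (1 - zw) q in weight D + 2 are those of - zw q_D,
    where q_D is the component of weight D of q. On the line of monomials
    z^(A - n) zbar^(B - n) t^n with A + B = D + 2, they read
    c_n = - (r_n + 4 r_(n-1)), so that the sum of the c_n (-1/4)^n telescopes to 0
    and harmonicity forces every c_n, hence every r_n, to vanish. *)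
Lemma top_weight_eq0 q D :
  zlap ((1 - zw) * q) = 0 ->
  (forall a b n, (D < a + b + 2 * n)%N -> q@_(mon a b n) = 0) ->
  forall a b n, (a + b + 2 * n = D)%N -> q@_(mon a b n) = 0.
Proof.
move=> Lq0 qD a0 b0 n0 abnD.
have [A EA] : {A | A = (a0 + n0).+1} by exists (a0 + n0).+1.
have [B EB] : {B | B = (b0 + n0).+1} by exists (b0 + n0).+1.
have AB : (A + B = D.+2)%N by lia.
(* The two cases B <= A and A <= B differ by the sign of A - B, which goes into
   the choice of e among 'i and - 'i. *)
have [l [k [e [ei kA kB kAB eAB]]]] : exists l k e,
  [/\ e = 'i \/ e = - 'i :> C, (k <= A)%N, (k <= B)%N,
      forall j, (j <= k)%N -> ((A - (k - j)) * (B - (k - j)) = j * (j + l))%N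
   & forall n, (n <= k)%N -> 'i * ((A - n)%:R - (B - n)%:R) = e * l%:R ].
  have [BA|BA] := leqP B A.
    exists (A - B)%N, B, 'i; split=> //; first by left.
      by move=> j jB; nia.
    by move=> n nB; rewrite !natrB //; lia || ring.
  exists (B - A)%N, A, (- 'i); split=> //; first by right.
  - exact: ltnW.
  - by move=> j jB; nia.
  by move=> n nB; rewrite !natrB //; lia || ring.
have ABk : (A - k = 0 \/ B - k = 0)%N.
  have /eqP := kAB 0%N (leq0n k).
  by rewrite subn0 mul0n muln_eq0 => /orP[] /eqP->; auto.
set u := (1 - zw) * q in Lq0.
pose c n := if (n <= k)%N then u@_(mon (A - n) (B - n) n) else 0.
pose r n := if (n < k)%N then q@_(mon (A - n.+1) (B - n.+1) n) else 0.
have boxE (p : mp) n i : (n <= k)%N ->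
    coef_pred01 p (A - n)%N (B - n)%N i = if (n < k)%N then p@_(mon (A - n.+1) (B - n.+1) i) else 0.
  rewrite /coef_pred01 leq_eqVlt => /orP[/eqP->|nk]; first by rewrite ltnn; case: ABk => ->; case: (A - k)%N.
  have An : (0 < A - n)%N by rewrite subn_gt0 (leq_trans nk kA).
  have Bn : (0 < B - n)%N by rewrite subn_gt0 (leq_trans nk kB).
  rewrite nk !subnS; move: An Bn.
  by case: (A - n)%N (B - n)%N => [|a] [|b].
have c0E : c 0%N = - r 0%N.
  rewrite /c leq0n mcoeff_1Bzw boxE // qD ?sub0r ?mulr0 ?subr0 //; lia.
have cSE n : c n.+1 = - (r n.+1 + 4 * r n).
  rewrite /c; case: ifPn => [nk|]; last first.
    by rewrite -leqNgt /r => kn; rewrite !ifF ?mulr0 ?addr0 ?oppr0 //; lia.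
  by rewrite mcoeff_1Bzw boxE // qD ?sub0r ?opprD /r ?nk //; lia.
have csum n : \sum_(i < n.+1) c i * (- 4^-1) ^+ i = - (r n * (- 4^-1) ^+ n).
  elim: n => [|n IHn]; first by rewrite big_ord1 c0E mulNr.
  rewrite big_ord_recr /= IHn cSE exprS.
  have : - 4^-1 * 4 = - 1 :> C by rewrite mulNr mulVf // pnatr_eq0.
  move: (- 4^-1) => x x4.
  have -> : - (r n * x ^+ n) + - (r n.+1 + 4 * r n) * (x * x ^+ n) =
     - (r n.+1 * (x * x ^+ n)) - r n * x ^+ n * (1 + x * 4) by ring.
  by rewrite x4 subrr mulr0 subr0.
have c0 : forall n, c n = 0.
  apply: (@harmonic_line_eq0 _ e l k c ei) => [n nk | j jk | ].
  - by rewrite /c leqNgt nk.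
  - have := mcoeff_zlap u (A - (k - j)) (B - (k - j)) (k - j.+1).
    rewrite Lq0 mcoeff0 boxE ?leq_subr // => /esym/eqP.
    rewrite mulf_eq0 pnatr_eq0 /= eAB ?leq_subr //.
    have -> : (A - (k - j)).+1 = (A - (k - j.+1))%N by lia.
    have -> : (B - (k - j)).+1 = (B - (k - j.+1))%N by lia.
    rewrite kAB //.
    have -> : (k - j.+1).+2 = (k - j).+1 by lia.
    have -> : (k - j.+1).+1 = (k - j)%N by lia.
    rewrite subr_eq0 => /eqP E; rewrite /c !leq_subr -E; exact: esym (addrK _ _).
  - by rewrite csum /r ltnn mul0r oppr0.
have r0 n : r n = 0.
  elim: n => [|n IHn]; first by apply/eqP; rewrite -oppr_eq0 -c0E c0.
  by have /esym/eqP := cSE n; rewrite c0 IHn mulr0 addr0 oppr_eq0 => /eqP.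
have nk : (n0 < k)%N.
  by case: ABk; lia.
by have := r0 n0; rewrite /r nk EA EB !subSS !addnK.
Qed.

Lemma mdeg3 (s : 'X_{1..3}) :
  mdeg s = (s (0%R : 'I_3) + s (1%R : 'I_3) + s (2%R : 'I_3))%N.
Proof.
rewrite mdegE 3!big_ord_recl big_ord0 addn0 addnA.
by congr (s _ + s _ + s _)%N; apply: val_inj.
Qed.

Lemma mdeg_mon a b n : mdeg (mon a b n) = (a + b + n)%N.
Proof. by rewrite mdeg3 !mnmE. Qed.

(** Otherwise the component of q of top weight would contradict
    [top_weight_eq0]; the induction lowers a bound D on the weights in q. *)
Lemma zlap_1Bzw_inj q : zlap ((1 - zw) * q) = 0 -> q = 0.
Proof.
move=> Lq0; pose vanish D := forall a b n, (D <= a + b + 2 * n)%N -> q@_(mon a b n) = 0.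
have [D vD] : exists D, vanish D.
  exists (2 * msize q)%N => a b n sD; apply/memN_msupp_eq0/msize_mdeg_ge.
  by rewrite mdeg_mon; lia.
elim: D vD => [v0|D IHD vD]; first by apply: mpoly_mon0P => a b n; exact: v0.
apply: IHD => a b n; rewrite leq_eqVlt => /orP[/eqP/esym|]; last exact: vD.
exact: top_weight_eq0.
Qed.

(** The bound is written with an addition so that no monomial satisfies it when
    D < 2. *)
Definition wt_leB2 D : pred 'X_{1..3} := fun s => (wt s + 2 <= D)%N.

Lemma wt_mdeg s : (mdeg s <= wt s)%N.
Proof. by rewrite mdeg3 /wt; lia. Qed.

Lemma mcoeff_notin p (S : pred 'X_{1..3}) s : {subset msupp p <= S} -> ~~ S s -> p@_s = 0.
Proof. by move=> pS Ss; apply: memN_msupp_eq0; apply: contra Ss => /pS. Qed.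

Lemma msupp_zlap p D : (forall s, (D < wt s)%N -> p@_s = 0) ->
  {subset msupp (zlap p) <= wt_leB2 D}.
Proof.
move=> pD s; rewrite mcoeff_msupp unfold_in (monE s) wt_mon mcoeff_zlap.
set a := s _; set b := s _; set n := s _; rewrite leqNgt.
apply: contra => Dabn; rewrite !pD ?wt_mon; try lia.
have -> : coef_pred01 p a b n.+2 = 0.
  by rewrite /coef_pred01; case: a b Dabn => [|a] [|b] // H; rewrite pD // wt_mon; lia.
by rewrite !mulr0 addr0 subr0 mulr0.
Qed.

Lemma zlap_is_linear : linear zlap.
Proof.
move=> k p q; apply/mpolyP => s.
rewrite mcoeffD mcoeffZ (monE s) !mcoeff_zlap !mcoeffD !mcoeffZ /coef_pred01.
by case: (s _) (s _) => [|a] [|b]; rewrite ?mcoeffD ?mcoeffZ; ring.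
Qed.

Lemma zlap_1Bzw_surj g m : {subset msupp g <= wt_leB2 m} ->
  exists2 q, {subset msupp q <= wt_leB2 m} & zlap ((1 - zw) * q) = g.
Proof.
have linT : linear (fun q => zlap ((1 - zw) * q)).
  by move=> k p q; rewrite mulrDr -scalerAr zlap_is_linear.
pose T : {linear mp -> mp} := HB.pack (fun q => zlap ((1 - zw) * q))
  (GRing.isLinear.Build _ _ _ _ _ linT).
apply: (@mpoly_linear_inj_surj _ _ T _ m) => [s sm | q qm | q].
- by apply: leq_ltn_trans (wt_mdeg s) _; move: sm; rewrite /wt_leB2; lia.
- apply: msupp_zlap => s ms; rewrite (monE s) mcoeff_1Bzw.
  move: ms; rewrite {1}(monE s) wt_mon.
  set a := s _; set b := s _; set n := s _ => ms.
  have out a' b' n' : (m < a' + b' + 2 * n' + 2)%N -> q@_(mon a' b' n') = 0.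
    by move=> h; apply: mcoeff_notin qm _; rewrite /wt_leB2 wt_mon -ltnNge.
  rewrite /coef_pred01; case: n ms => [|n] ms; case: a ms => [|a] ms; case: b ms => [|b] ms;
   rewrite !out ?(mulr0, subr0) //; lia.
- exact: zlap_1Bzw_inj.
Qed.
End Wirtinger.

(** * Substitutions *)

Section Substitution.
Variables (K : comRingType) (n k : nat).

Lemma mpoly_morph_ind (P : {mpoly K[n]} -> Prop) :
  (forall c, P c%:MP) -> (forall p q, P p -> P q -> P (p + q)) ->
  (forall p q, P p -> P q -> P (p * q)) -> (forall i, P 'X_i) -> forall p, P p.
Proof.
move=> PC PD PM PX; elim/mpolyind => [|c s p _ _ Pp]; first by rewrite -mpolyC0; exact: PC.
apply: (PD _ _ _ Pp); rewrite -mul_mpolyC; apply: (PM _ _ (PC c)).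
rewrite mpolyXE_id; apply: (big_ind P) => [||i _]; [rewrite -mpolyC1; exact: PC | exact: PM | ].
by elim: (s i) => [|j IHj]; [rewrite expr0 -mpolyC1; exact: PC | rewrite exprS; exact: PM].
Qed.

Lemma mderiv_comp (p : {mpoly K[n]}) (lq : n.-tuple {mpoly K[k]}) (i : 'I_k) :
  mderiv i (p \mPo lq) = \sum_j (mderiv j p \mPo lq) * mderiv i (tnth lq j).
Proof.
elim/mpoly_morph_ind: p => [c | p q IHp IHq | p q IHp IHq | j].
- by rewrite comp_mpolyC mderivC big1 // => j _; rewrite mderivC comp_mpoly0 mul0r.
- rewrite comp_mpolyD mderivD IHp IHq -big_split; apply: eq_bigr => j _ /=.
  by rewrite mderivD comp_mpolyD mulrDl.
- rewrite rmorphM mderivM IHp IHq mulr_suml mulr_sumr -big_split.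
  by apply: eq_bigr => j _ /=; rewrite mderivM comp_mpolyD !rmorphM /=; ring.
- rewrite comp_mpolyXU -tnth_nth (bigD1 j) //= big1 => [|l lj].
    rewrite mderivX mnm1E eqxx scale1r (_ : (_ - _)%MM = 0%MM) ?mpolyX0.
      by rewrite comp_mpoly1 mul1r addr0.
    by apply/(mnmP _ _) => l; rewrite mnmBE subnn mnm0E.
  by rewrite mderivX mnm1E eq_sym (negPf lj) scale0r comp_mpoly0 mul0r.
Qed.

Lemma comp_mpolyA (m : nat) (p : {mpoly K[n]}) (lq : n.-tuple {mpoly K[k]})
    (lr : k.-tuple {mpoly K[m]}) :
  (p \mPo lq) \mPo lr = p \mPo [tuple of [seq q \mPo lr | q <- lq]].
Proof.
elim/mpoly_morph_ind: p => [c | p q IHp IHq | p q IHp IHq | j].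
- by rewrite !comp_mpolyC.
- by rewrite !comp_mpolyD IHp IHq.
- by rewrite !rmorphM /= IHp IHq.
- by rewrite !comp_mpolyXU -!tnth_nth tnth_map.
Qed.

End Substitution.

(** * Polynomials that vanish at natural points *)

Section Vanish.
Variable C : numClosedFieldType.

Lemma digits_inj N a b n a' b' n' :
  (a < N)%N -> (b < N)%N -> (a' < N)%N -> (b' < N)%N ->
  (a + N * (b + N * n) = a' + N * (b' + N * n'))%N -> [/\ a = a', b = b' & n = n'].
Proof.
have cancelN u v u' v' : (u < N)%N -> (u' < N)%N ->
    (u + N * v = u' + N * v')%N -> u = u' /\ v = v'.
  move=> uN u'N E; have N0 : (0 < N)%N by lia.
  have := congr1 (modn^~ N) E; have := congr1 (divn^~ N) E.
  by rewrite ![(_ + N * _)%N]addnC ![(N * _)%N]mulnC !modnMDl !divnMDl //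
    !modn_small // !divn_small // !addn0.
by move=> aN bN a'N b'N /cancelN[] // -> /cancelN[] // -> ->.
Qed.

(** Kronecker substitution: on the curve (i, i^N, i^(N^2)) with N above all
    exponents, distinct monomials restrict to distinct powers of i, so the
    polynomial becomes a univariate one with the same coefficients and
    infinitely many roots. *)
Lemma mpoly3_nat_eq0 (p : {mpoly C[3]}) :
  (forall x y t : nat, p.@[tnth [tuple x%:R; y%:R; t%:R]] = 0) -> p = 0.
Proof.
move=> p0; pose N := msize p.
pose K (s : 'X_{1..3}) :=
  (s (0%R : 'I_3) + N * (s (1%R : 'I_3) + N * s (2%R : 'I_3)))%N.
pose P : {poly C} := \sum_(s <- msupp p) p@_s *: 'X^(K s).
have P0 : P = 0.
  apply/eqP; apply: contraT => Pn0.
  pose rs := [seq (i%:R : C) | i <- iota 0 (size P)].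
  have := @max_poly_roots _ P rs Pn0; rewrite size_map size_iota ltnn => -> //.
    apply/allP => _ /mapP[i _ ->]; apply/rootP.
    rewrite -(p0 i (i ^ N)%N (i ^ (N * N))%N) mevalE horner_sum.
    apply: eq_bigr => s _; rewrite hornerZ hornerXn 3!big_ord_recl big_ord0 mulr1.
    by rewrite /K !natrX -!exprM -!exprD; congr (_ * _ ^+ _);
      rewrite mulnDr !mulnA; congr (_ + (_ + _))%N; congr (_ * _)%N; congr (s _);
      apply: val_inj.
  by rewrite map_inj_uniq ?iota_uniq // => i j /eqP; rewrite eqr_nat => /eqP.
have KN s i : s \in msupp p -> (s i < N)%N.
  by move/msize_mdeg_lt; apply: leq_ltn_trans; rewrite mdegE (bigD1 i) ?leq_addr.
apply/mpolyP => s; rewrite mcoeff0; apply/eqP; rewrite mcoeff_eq0; apply/negP => sp.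
have := congr1 (fun P : {poly C} => P`_(K s)) P0; rewrite coef0 coef_sum.
rewrite (bigD1_seq s) ?msupp_uniq //= coefZ coefXn eqxx mulr1 big_seq_cond big1.
  by rewrite addr0 => /eqP; rewrite mcoeff_eq0 sp.
move=> s' /andP[s'p s's]; rewrite coefZ coefXn; case: eqP => [E|]; last by rewrite mulr0.
have [e0 e1 e2] := digits_inj (KN _ _ sp) (KN _ _ sp) (KN _ _ s'p) (KN _ _ s'p) E.
by case/eqP: s's; apply/(mnmP _ _); apply: ord3P.
Qed.
End Vanish.

(** * The change of variables between (x, y, t) and (z, zbar, t) *)

(** The sum of the squares of X = d_z + d_zbar - i (z - zbar) d_t and
    Y = i (d_z - d_zbar) - (z + zbar) d_t, expanded in terms of the second
    derivatives pjk of a polynomial and of its derivative c along t. In the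
    formula, the letters X and Y denote the variables z and zbar. *)
Lemma wirtinger_identity (K : comNzRingType) (A : comAlgType K) (i : K)
    (p00 p01 p02 p11 p12 p22 c X Y : A) : i * i = - 1 ->
  (p00 + p01 - i *: (c + (X - Y) * p02)) + (p01 + p11 - i *: (- c + (X - Y) * p12))
   - i *: ((X - Y) * (p02 + p12 - i *: ((X - Y) * p22)))
  + (i *: (i *: (p00 - p01) - (c + (X + Y) * p02) - (i *: (p01 - p11) - (c + (X + Y) * p12)))
   - (X + Y) * (i *: (p02 - p12) - (X + Y) * p22))
  = 4 *: (p01 + X * (Y * p22) - i *: (X * p02 - Y * p12)).
Proof.
move=> ii.
have [f fE] : exists f : K -> A, forall k x, k *: x = f k * x.
  by exists (fun k => k%:A) => k x; rewrite mulr_algl.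
have JJ : 1 + f i * f i = 0.
  by rewrite -[f i * f i]mulr1 -mulrA -!fE scalerA ii scaleN1r subrr.
have f4 : f 4 = 4%:R by rewrite -[f 4]mulr1 -fE scaler_nat.
rewrite !fE f4; move: (f i) JJ => J JJ; apply: subr0_eq.
set L := (X in X = 0).
have -> : L = (1 + J * J) * (p00 - 2%:R * p01 + p11 + (X - Y) ^+ 2 * p22).
  rewrite /L; ring.
by rewrite JJ mul0r.
Qed.

Section ChangeOfVariables.
Variable C : numClosedFieldType.
Local Notation mp := {mpoly C[3]}.
Local Notation I := ('i : C).
Implicit Types (p q : mp).

Definition zcoord : 3.-tuple mp := [tuple 'X_0 + I *: 'X_1; 'X_0 - I *: 'X_1; 'X_2].
Definition xcoord : 3.-tuple mp :=
  [tuple 2^-1 *: ('X_0 + 'X_1); (2 * I)^-1 *: ('X_0 - 'X_1); 'X_2].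
(** Over an arbitrary algebraically closed numerical field; over R[i] these are
    the fields X, Y and the sub-Laplacian by definition. *)
Definition hX p : mp := mderiv 0 p + 2%:R * 'X_1 * mderiv 2 p.
Definition hY p : mp := mderiv 1 p - 2%:R * 'X_0 * mderiv 2 p.
Definition hlap p : mp := hX (hX p) + hY (hY p).

(** of_z rewrites a polynomial in (z, zbar, t) in terms of (x, y, t), and to_z
    does the converse. *)
Definition of_z p : mp := p \mPo zcoord.
Definition to_z p : mp := p \mPo xcoord.

Lemma comp_XU (lq : 3.-tuple mp) (i : 'I_3) : 'X_i \mPo lq = tnth lq i.
Proof. by rewrite comp_mpolyXU -tnth_nth. Qed.

Lemma comp_id p (lq : 3.-tuple mp) :
  tnth lq 0 = 'X_0 -> tnth lq 1 = 'X_1 -> tnth lq 2 = 'X_2 -> p \mPo lq = p.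
Proof.
move=> e0 e1 e2.
have -> : lq = [tuple 'X_i | i < 3].
  apply: eq_from_tnth => i; rewrite tnth_mktuple.
  elim/ord3P: i; [exact: e0 | exact: e1 | exact: e2].
exact: comp_mpoly_id.
Qed.

Lemma scale_half_double (q : mp) : 2^-1 *: (q + q) = q.
Proof. by rewrite -mulr2n -[q *+ 2]scaler_nat scalerA mulVf ?scale1r // pnatr_eq0. Qed.

Lemma to_zK p : of_z (to_z p) = p.
Proof.
rewrite /of_z /to_z comp_mpolyA; apply: comp_id; rewrite tnth_map.
- rewrite /tnth /= comp_mpolyZ comp_mpolyD !comp_XU /tnth /= addrACA subrr addr0.
  exact: scale_half_double.
- rewrite /tnth /= comp_mpolyZ comp_mpolyB !comp_XU /tnth /= opprB [X in _ + X]addrC addrACA subrr add0r.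
  rewrite invfM mulrC -scalerA scale_half_double scalerA mulVf ?scale1r //.
  exact: neq0Ci.
- by rewrite comp_XU.
Qed.

Lemma of_zK p : to_z (of_z p) = p.
Proof.
rewrite /of_z /to_z comp_mpolyA; apply: comp_id; rewrite tnth_map.
- rewrite /tnth /= comp_mpolyD comp_mpolyZ !comp_XU /tnth /= scalerA invfM mulrCA mulfV ?neq0Ci //.
  by rewrite mulr1 -scalerDr addrACA subrr addr0 scale_half_double.
- rewrite /tnth /= comp_mpolyB comp_mpolyZ !comp_XU /tnth /= scalerA invfM mulrCA mulfV ?neq0Ci //.
  by rewrite mulr1 -scalerBr opprB [X in _ + X]addrC addrACA subrr add0r scale_half_double.
- by rewrite comp_XU.
Qed.

Lemma of_z_zw : of_z (zw C) = 'X_0 ^+ 2 + 'X_1 ^+ 2 + 4%:R * 'X_2.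
Proof.
rewrite /of_z /zw comp_mpolyD comp_mpolyZ rmorphM /= !comp_XU /tnth /=.
rewrite scaler_nat [4%:R * _]mulr_natl; congr (_ + _).
by rewrite mulrC -subr_sqr exprZn sqrCi scaleN1r opprK.
Qed.

Lemma hlap_of_z p : hlap (of_z p) = of_z (zlap p).
Proof.
have sum3 (F : 'I_3 -> mp) : \sum_j F j = F 0 + F 1 + F 2.
  rewrite 3!big_ord_recl big_ord0 addr0 addrA.
  by congr (F _ + F _ + F _); apply: val_inj.
have dE (i : 'I_3) q : mderiv i (of_z q) =
    of_z (mderiv 0 q) * mderiv i ('X_0 + I *: 'X_1) + of_z (mderiv 1 q) * mderiv i ('X_0 - I *: 'X_1)
    + of_z (mderiv 2 q) * mderiv i 'X_2.
  by rewrite [LHS]mderiv_comp sum3.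
have dXe (i : 'I_3) : mderiv i ('X_i : mp) = 1.
  rewrite mderivX mnm1E eqxx scale1r (_ : (_ - _)%MM = 0%MM) ?mpolyX0 //.
  by apply/(mnmP _ _) => l; rewrite mnmBE subnn mnm0E.
have dXn (i j : 'I_3) : i != j -> mderiv i ('X_j : mp) = 0.
  by move=> ij; rewrite mderivX mnm1E eq_sym (negPf ij) scale0r.
have dZ (i : 'I_3) a b : mderiv i ('X_0 : mp) = a -> mderiv i ('X_1 : mp) = b ->
    mderiv i ('X_0 + I *: 'X_1 : mp) = a + I *: b /\
    mderiv i ('X_0 - I *: 'X_1 : mp) = a - I *: b.
  by move=> <- <-; rewrite mderivB mderivD mderivZ.
have tD q r : of_z (q + r) = of_z q + of_z r by exact: comp_mpolyD.
have tB q r : of_z (q - r) = of_z q - of_z r by exact: comp_mpolyB.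
have tZ c q : of_z (c *: q) = c *: of_z q by exact: comp_mpolyZ.
have dxE q : mderiv 0 (of_z q) = of_z (mderiv 0 q + mderiv 1 q).
  have [e1 e2] := dZ 0 _ _ (dXe 0) (dXn 0 1 isT); have e3 := dXn 0 2 isT.
  rewrite dE e1 e2 e3 tD; move: (of_z _) (of_z _) (of_z _) => x y z.
  by rewrite scaler0 subr0 addr0 !mulr1 mulr0 addr0.
have dyE q : mderiv 1 (of_z q) = of_z (I *: (mderiv 0 q - mderiv 1 q)).
  have [e1 e2] := dZ 1 _ _ (dXn 1 0 isT) (dXe 1); have e3 := dXn 1 2 isT.
  rewrite dE e1 e2 e3 tZ tB; move: (of_z _) (of_z _) (of_z _) => x y z.
  by rewrite add0r sub0r mulr0 addr0 mulrN -mulrBl -scalerAr mulr1.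
have dtE q : mderiv 2 (of_z q) = of_z (mderiv 2 q).
  have [e1 e2] := dZ 2 _ _ (dXn 2 0 isT) (dXn 2 1 isT); have e3 := dXe 2.
  rewrite dE e1 e2 e3; move: (of_z _) (of_z _) (of_z _) => x y z.
  by rewrite scaler0 subr0 addr0 !mulr0 mulr1 !add0r.
have tM q r : of_z (q * r) = of_z q * of_z r by exact: rmorphM.
have tX : 2%:R * 'X_0 = of_z ('X_0 + 'X_1).
  by rewrite /of_z comp_mpolyD !comp_XU /tnth /= addrACA subrr addr0 mulr_natl mulr2n.
have tY : 2%:R * 'X_1 = of_z (- I *: ('X_0 - 'X_1)).
  rewrite /of_z comp_mpolyZ comp_mpolyB !comp_XU /tnth /= opprB [X in _ + X]addrC addrACA subrr add0r.
  by rewrite -scalerDr scalerA mulNr -expr2 sqrCi opprK scale1r mulr_natl mulr2n.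
have fX q : hX (of_z q) =
    of_z (mderiv 0 q + mderiv 1 q - I *: (('X_0 - 'X_1) * mderiv 2 q)).
  rewrite /hX dxE dtE tY -tM -tD; congr (of_z (_ + _)).
  by rewrite scaleNr mulNr -scalerAl.
have fY q : hY (of_z q) =
    of_z (I *: (mderiv 0 q - mderiv 1 q) - ('X_0 + 'X_1) * mderiv 2 q).
  rewrite /hY dyE dtE tX -tM -tB; reflexivity.
rewrite /hlap !fX !fY -tD; congr of_z; rewrite /zlap.
set p0 := mderiv 0 p; set p1 := mderiv 1 p; set p2 := mderiv 2 p.
have dX0 : forall i : 'I_3, mderiv i ('X_0 - 'X_1 : mp) = (i == 0)%:R - (i == 1)%:R.
  by elim/ord3P; rewrite mderivB ?dXe ?dXn.
have dX1 : forall i : 'I_3, mderiv i ('X_0 + 'X_1 : mp) = (i == 0)%:R + (i == 1)%:R.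
  by elim/ord3P; rewrite mderivD ?dXe ?dXn.
have eX (i : 'I_3) : mderiv i (p0 + p1 - I *: (('X_0 - 'X_1) * p2)) =
   mderiv i p0 + mderiv i p1 - I *: (((i == 0)%:R - (i == 1)%:R) * p2
     + ('X_0 - 'X_1) * mderiv i p2).
  by rewrite mderivB mderivD mderivZ mderivM dX0.
have eY (i : 'I_3) : mderiv i (I *: (p0 - p1) - ('X_0 + 'X_1) * p2) =
   I *: (mderiv i p0 - mderiv i p1) - (((i == 0)%:R + (i == 1)%:R) * p2
     + ('X_0 + 'X_1) * mderiv i p2).
  by rewrite mderivB mderivZ mderivB mderivM dX1.
have X_0 : mderiv 0 (p0 + p1 - I *: (('X_0 - 'X_1) * p2)) =
    mderiv 0 p0 + mderiv 0 p1 - I *: (p2 + ('X_0 - 'X_1) * mderiv 0 p2).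
  have d : (0 == 0 :> 'I_3)%:R - (0 == 1 :> 'I_3)%:R = 1 :> mp by rewrite subr0.
  rewrite eX d [X in X + ('X_0 - 'X_1) * _]mul1r; reflexivity.
have X_1 : mderiv 1 (p0 + p1 - I *: (('X_0 - 'X_1) * p2)) =
    mderiv 1 p0 + mderiv 1 p1 - I *: (- p2 + ('X_0 - 'X_1) * mderiv 1 p2).
  have d : (1 == 0 :> 'I_3)%:R - (1 == 1 :> 'I_3)%:R = -1 :> mp by rewrite sub0r.
  rewrite eX d [X in X + ('X_0 - 'X_1) * _]mulN1r; reflexivity.
have X_2 : mderiv 2 (p0 + p1 - I *: (('X_0 - 'X_1) * p2)) =
    mderiv 2 p0 + mderiv 2 p1 - I *: (('X_0 - 'X_1) * mderiv 2 p2).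
  have d : (2 == 0 :> 'I_3)%:R - (2 == 1 :> 'I_3)%:R = 0 :> mp by rewrite subr0.
  rewrite eX d [X in X + ('X_0 - 'X_1) * _]mul0r [X in I *: X]add0r; reflexivity.
have Y_0 : mderiv 0 (I *: (p0 - p1) - ('X_0 + 'X_1) * p2) =
    I *: (mderiv 0 p0 - mderiv 0 p1) - (p2 + ('X_0 + 'X_1) * mderiv 0 p2).
  have d : (0 == 0 :> 'I_3)%:R + (0 == 1 :> 'I_3)%:R = 1 :> mp by rewrite addr0.
  rewrite eY d [X in X + ('X_0 + 'X_1) * _]mul1r; reflexivity.
have Y_1 : mderiv 1 (I *: (p0 - p1) - ('X_0 + 'X_1) * p2) =
    I *: (mderiv 1 p0 - mderiv 1 p1) - (p2 + ('X_0 + 'X_1) * mderiv 1 p2).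
  have d : (1 == 0 :> 'I_3)%:R + (1 == 1 :> 'I_3)%:R = 1 :> mp by rewrite add0r.
  rewrite eY d [X in X + ('X_0 + 'X_1) * _]mul1r; reflexivity.
have Y_2 : mderiv 2 (I *: (p0 - p1) - ('X_0 + 'X_1) * p2) =
    I *: (mderiv 2 p0 - mderiv 2 p1) - ('X_0 + 'X_1) * mderiv 2 p2.
  have d : (2 == 0 :> 'I_3)%:R + (2 == 1 :> 'I_3)%:R = 0 :> mp by rewrite addr0.
  rewrite eY d [X in X + ('X_0 + 'X_1) * _]mul0r [X in _ - X]add0r; reflexivity.
have p10 : mderiv 0 p1 = mderiv 1 p0 by exact: mderiv_comm.
have p02 : mderiv 0 p2 = mderiv 2 p0 by exact: mderiv_comm.
have p12 : mderiv 1 p2 = mderiv 2 p1 by exact: mderiv_comm.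
rewrite X_0 X_1 X_2 Y_0 Y_1 Y_2 p10 p02 p12.
apply: wirtinger_identity.
by rewrite -expr2 sqrCi.
Qed.

End ChangeOfVariables.

(** * Weights, dilations and solvability *)

Section Solvability.
Variable C : numClosedFieldType.
Local Notation mp := {mpoly C[3]}.
Local Notation I := ('i : C).
Implicit Types (p q : mp).

Lemma of_z_inj : injective (@of_z C).
Proof. exact: can_inj (@of_zK C). Qed.

(** The coordinates (z, zbar, t) of the point (x, y, t). *)
Definition zpoint (x y t : C) : 'I_3 -> C := tnth [tuple x + I * y; x - I * y; t].

Lemma meval_of_z p (x y t : C) :
  (of_z p).@[tnth [tuple x; y; t]] = p.@[zpoint x y t].
Proof.
rewrite /of_z comp_mpoly_meval; apply: meval_eq; apply: ord3P; rewrite /tnth /=.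
- by rewrite mevalD mevalZ !mevalXU.
- by rewrite mevalB mevalZ !mevalXU.
- by rewrite mevalXU.
Qed.

Lemma zpoint_nat_eq0 p : (forall x y t : nat, p.@[zpoint x%:R y%:R t%:R] = 0) -> p = 0.
Proof.
move=> p0; apply: of_z_inj; rewrite [RHS]comp_mpoly0.
by apply: mpoly3_nat_eq0 => x y t; rewrite meval_of_z.
Qed.

Definition dilw (r : C) (v : 'I_3 -> C) : 'I_3 -> C :=
  tnth [tuple r * v 0; r * v 1; r ^+ 2 * v 2].

Lemma meval_dilw p (r : C) v :
  p.@[dilw r v] = \sum_(s <- msupp p) p@_s * (r ^+ wt s * ('X_[s]).@[v]).
Proof.
rewrite mevalE; apply: eq_bigr => s _; congr (_ * _).
have p3 (F : 'I_3 -> C) : \prod_i F i = F 0 * F 1 * F 2.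
  rewrite 3!big_ord_recl big_ord0 mulr1 mulrA.
  by congr (F _ * F _ * F _); apply: val_inj.
rewrite mevalX !p3 /dilw /tnth /= !exprMn /wt mul2n -addnn !exprD; ring.
Qed.

(** The single dilation factor 2 detects the weight, since the powers of 2 are
    distinct. *)
Lemma dilw_wt p m : (forall x y t : nat,
     p.@[dilw 2%:R (zpoint x%:R y%:R t%:R)] = 2%:R ^+ m * p.@[zpoint x%:R y%:R t%:R]) ->
  forall s, s \in msupp p -> wt s = m.
Proof.
move=> pm s sp.
pose d : mp := \sum_(s <- msupp p) ((2%:R ^+ wt s - 2%:R ^+ m) * p@_s) *: 'X_[s].
have d0 : d = 0.
  apply: zpoint_nat_eq0 => x y t; have := pm x y t; set v := zpoint _ _ _.
  rewrite meval_dilw => /eqP; rewrite -subr_eq0 {3}[p]mpolyE => /eqP e; rewrite -[RHS]e /d.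
  rewrite !raddf_sum /= mulr_sumr -sumrB; apply: eq_bigr => s' _.
  by rewrite !mevalZ; ring.
have := congr1 (mcoeff s) d0; rewrite mcoeff0 raddf_sum (bigD1_seq s) ?msupp_uniq //=.
rewrite mcoeffZ mcoeffX eqxx mulr1 big1 ?addr0 => [/eqP|s' /negPf s's]; last first.
  by rewrite mcoeffZ mcoeffX s's mulr0.
rewrite mulf_eq0 mcoeff_eq0 sp orbF subr_eq0.
by rewrite -!natrX eqr_nat eqn_exp2l // => /eqP.
Qed.

Lemma wt_dilw p m (r : C) v : (forall s, s \in msupp p -> wt s = m) ->
  p.@[dilw r v] = r ^+ m * p.@[v].
Proof.
move=> pm; rewrite meval_dilw {3}[p]mpolyE raddf_sum mulr_sumr /=.
by rewrite !big_seq; apply: eq_bigr => s sp; rewrite mevalZ (pm s sp) mulrCA.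
Qed.

Lemma wt_split q n : {subset msupp q <= @wt_leB2 n.+2} ->
  exists f : 'I_n.+1 -> mp,
  (forall (j : 'I_n.+1) s, s \in msupp (f j) -> wt s = j) /\ q = \sum_(j < n.+1) f j.
Proof.
move=> qn; exists (fun j : 'I_n.+1 => \sum_(s <- msupp q | wt s == j) q@_s *: 'X_[s]).
split=> [j s | ].
  rewrite mcoeff_msupp raddf_sum /=; apply: contraNeq => sj; apply/eqP.
  rewrite big1 // => s' /eqP s'j.
  rewrite mcoeffZ mcoeffX; case: eqP => [e|]; last by rewrite mulr0.
  by case/eqP: sj; rewrite -e.
rewrite {1}[q]mpolyE; under [RHS]eq_bigr do rewrite big_mkcond.
rewrite exchange_big /=; apply: eq_big_seq => s /qn sn.
have ns : (wt s < n.+1)%N by move: sn; rewrite unfold_in /wt_leB2; lia.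
rewrite (bigD1 (Ordinal ns)) //= eqxx big1 ?addr0 // => j.
by rewrite -val_eqE /= eq_sym => /negPf ->.
Qed.

Local Notation w := ('X_0 ^+ 2 + 'X_1 ^+ 2 + 4%:R * 'X_2 : mp).

Lemma hlap_1Bw q : hlap ((1 - w) * of_z q) = of_z (zlap ((1 - zw C) * q)).
Proof.
rewrite -hlap_of_z; congr hlap; rewrite -of_z_zw /of_z rmorphM rmorphB /=.
by rewrite comp_mpoly1.
Qed.

Lemma hlapD p q : hlap (p + q) = hlap p + hlap q.
Proof.
have XD u v : hX (u + v) = hX u + hX v by rewrite /hX !mderivD mulrDr addrACA.
have YD u v : hY (u + v) = hY u + hY v by rewrite /hY !mderivD mulrDr opprD addrACA.
by rewrite /hlap !XD !YD addrACA.
Qed.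

Lemma hlap_1Bw_inj q : hlap ((1 - w) * q) = 0 -> q = 0.
Proof.
rewrite -(to_zK q) hlap_1Bw -[0](comp_mpoly0 (zcoord C)) => /of_z_inj/zlap_1Bzw_inj ->.
by [].
Qed.

(** The operator q |-> Delta ((1 - w) q) maps the polynomials of weighted degree
    at most m - 2 to themselves, and Delta p lies in that space. *)
Lemma hlap_1Bw_surj p m : (forall s, s \in msupp p -> wt s = m) ->
  exists2 q, {subset msupp q <= @wt_leB2 m}
    & hlap ((1 - w) * of_z q) = - hlap (of_z p).
Proof.
move=> pm.
have [q qm Lq] : exists2 q, {subset msupp q <= @wt_leB2 m} &
    zlap ((1 - zw C) * q) = - zlap p.
  apply: zlap_1Bzw_surj => s; rewrite mcoeff_msupp mcoeffN oppr_eq0 -mcoeff_msupp.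
  apply: msupp_zlap => {}s ms; apply: memN_msupp_eq0; apply/negP => /pm sm.
  by rewrite sm ltnn in ms.
by exists q => //; rewrite hlap_1Bw Lq hlap_of_z; exact: comp_mpolyN.
Qed.

End Solvability.

(** * The Heisenberg group *)

Local Open Scope complex_scope.

Lemma evalH_of_z (R : realType) (p : hpoly R) (x y t : R) :
  evalH (of_z p) (x +i* y, t) = p.@[zpoint x%:C y%:C t%:C].
Proof. exact: meval_of_z. Qed.

Lemma dilation_zpoint (R : realType) (r x y t : R) (p : hpoly R) :
  evalH (of_z p) (dilation r (x +i* y, t)) =
  p.@[dilw r%:C (zpoint x%:C y%:C t%:C)].
Proof.
have -> : dilation r (x +i* y, t) = ((r * x) +i* (r * y), r ^+ 2 * t).
  congr pair; apply/eqP.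
  by rewrite eq_complex /= !mul0r subr0 addr0 !eqxx.
rewrite evalH_of_z; apply: meval_eq.
apply: ord3P; rewrite /zpoint /dilw /tnth /= !rmorphM ?rmorphXn /=; ring.
Qed.

Lemma homogH_wt (R : realType) (m : nat) (p : hpoly R) :
  homogH m (of_z p) -> forall s, s \in msupp p -> wt s = m.
Proof.
move=> hp; apply: dilw_wt => x y t.
have := hp 2%:R (ltr0n _ 2) (x%:R +i* y%:R, t%:R).
by rewrite dilation_zpoint evalH_of_z !rmorph_nat.
Qed.

Lemma wt_homogH (R : realType) (m : nat) (p : hpoly R) :
  (forall s, s \in msupp p -> wt s = m) -> homogH m (of_z p).
Proof.
by move=> pm r _ [[x y] t]; rewrite dilation_zpoint evalH_of_z; exact: wt_dilw.
Qed.

(** For m < 2 both sides only allow the zero polynomial. *)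
Lemma wt_wdeg_le (R : realType) (m : nat) (q : hpoly R) :
  {subset msupp q <= @wt_leB2 m} -> wdeg_le (m%:Z - 2) (of_z q).
Proof.
have lt2 : (m < 2)%N -> {subset msupp q <= @wt_leB2 m} -> of_z q = 0.
  move=> m2 qm; suff -> : q = 0 by exact: comp_mpoly0.
  by apply/mpolyP => s; rewrite mcoeff0; apply: (mcoeff_notin qm); rewrite /wt_leB2; lia.
case: m lt2 => [|[|n]] lt2 qn; [exact: lt2 | exact: lt2 |].
rewrite (_ : n.+2%:Z - 2 = n%:Z); last by lia.
have [f [fw ->]] := wt_split qn.
exists (fun j => of_z (f j)); split; first by move=> j; exact/wt_homogH/fw.
exact: raddf_sum.
Qed.

Lemma evalH_wpoly (R : realType) (h : heis R) :
  evalH wpoly h = `|h.1| ^+ 2 + 4%:R * h.2%:C.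
Proof.
have -> : `|h.1| ^+ 2 = (complex.Re h.1)%:C ^+ 2 + (complex.Im h.1)%:C ^+ 2.
  rewrite normc_def -rmorphXn /= sqr_sqrtr ?addr_ge0 ?sqr_ge0 //.
  by rewrite rmorphD !rmorphXn.
rewrite /evalH /wpoly !mevalD !mevalM !mevalXU /tnth /=.
by rewrite -mpolyC_nat mevalC.
Qed.

Theorem proposition6p2 (R : realType) (m : nat) (p : hpoly R)
    (hp : homogH m p) :
  (exists! q : hpoly R,
     wdeg_le (m%:Z - 2) q /\
     sublaplacian ((1 - wpoly) * q) = - sublaplacian p) /\
  (forall q : hpoly R,
     wdeg_le (m%:Z - 2) q ->
     sublaplacian ((1 - wpoly) * q) = - sublaplacian p ->
     let u : hpoly R := p + (1 - wpoly) * q in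
     harmonic u /\
     (forall h : heis R, evalH wpoly h = 1 -> evalH u h = evalH p h)) /\
  (forall h : heis R,
     evalH wpoly h = 1 <-> h.2%:C = (1 - `|h.1| ^+ 2) / 4%:R).
Proof.
split; last split.
- have pE := to_zK p; have pm : forall s, s \in msupp (to_z p) -> wt s = m.
    by apply: homogH_wt; rewrite pE.
  have [q qm Lq] := hlap_1Bw_surj pm; rewrite pE in Lq.
  exists (of_z q); split=> [|q2 [_ Lq2]].
    by split; [exact: wt_wdeg_le | exact: Lq].
  apply: subr0_eq; apply: hlap_1Bw_inj; apply: (@addIr _ (- hlap p)).
  by rewrite -{1}Lq2 add0r -[RHS]Lq -hlapD -mulrDr subrK.
- move=> q _ Lq u; split=> [|h w1].
    by rewrite /harmonic [LHS]hlapD [X in _ + X]Lq; exact: subrr.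
  by rewrite /u /evalH mevalD mevalM mevalB meval1 [X in 1 - X]w1 subrr mul0r addr0.
move=> h; rewrite evalH_wpoly; split=> [E|->].
  by rewrite -[X in X - _]E addrAC subrr add0r mulrC mulKf // pnatr_eq0.
by rewrite mulrC divfK ?pnatr_eq0 // addrC subrK.
Qed.
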